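(* Let $\mathbb{K}$ be a field of characteristic $0$ and $d\ge1$. The objects in the category $\mathbf{Sym}_0(d,1)$ are the nondegenerate symmetric bilinear forms $B_{d,1}^{A}$ determined by a $d\times d$ symmetric and regular (invertible) matrix $A$. Moreover: (i) Two such bilinear forms $B_{d,1}^{A_1}$ and $B_{d,1}^{A_2}$ are isomorphic in $\mathbf{Sym}_0(d,1)$ if and only if $A_1$ and $A_2$ are congruent. (ii) Any quadratic Lie algebra of the form $(\mathfrak{n}_{d,1},B_{d,1}^{A})$ decomposes as an orthogonal direct sum of $1$-dimensional ideals which are quadratic Lie algebras (with the restricted form). (iii) $(\mathfrak{n}_{d,1},B_{d,1}^{A_1})$ and $(\mathfrak{n}_{d,1},B_{d,1}^{A_2})$ are isomorphic as metric Lie algebras if and only if the matrices $A_1$ and $A_2$ are congruent.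
   Context: $\mathfrak{n}_{d,1}$ is the free $1$-nilpotent Lie algebra on $d$ generators $x_1,\dots,x_d$, i.e. the $d$-dimensional abelian Lie algebra with basis $x_1,\dots,x_d$; $B_{d,1}^A$ is the bilinear form on it with matrix $A$ in this basis. Matrices $A,B$ are congruent if $B=P^tAP$ for some invertible $P$. A bilinear form $B$ on a Lie algebra is invariant if $B([x,y],z)=B(x,[y,z])$; a quadratic (metric) Lie algebra is a Lie algebra with a nondegenerate symmetric invariant bilinear form; an isomorphism of metric Lie algebras is a Lie algebra isomorphism preserving the forms. For a Lie algebra, $\mathfrak{n}^1=\mathfrak{n}$, $\mathfrak{n}^i=[\mathfrak{n}^{i-1},\mathfrak{n}]$. For $d,t\geq 1$, with $\mathfrak{n}_{d,t}$ the free $t$-nilpotent Lie algebra on $d$ generators, $\mathbf{Sym}_0(d,t)$ is the category whose objects are the invariant symmetric bilinear forms $B$ on $\mathfrak{n}_{d,t}$ with $\mathrm{Ker}(B)\subseteq \mathfrak{n}_{d,t}^2$ and $\mathfrak{n}_{d,t}^t\nsubseteq \mathrm{Ker}(B)$, where $\mathrm{Ker}(B)=\{x : B(x,y)=0\ \forall y\}$. For objects $B_1,B_2$ let $MEnd_\perp(B_1,B_2)$ be the set of Lie algebra endomorphisms $\varphi$ of $\mathfrak{n}_{d,t}$ such that $B_1(x,y)=B_2(\varphi(x),\varphi(y))$ for all $x,y$ and $\varphi(\mathrm{Ker}(B_1))\subseteq \mathrm{Ker}(B_2)$. Then $Hom(B_1,B_2)=MEnd_\perp(B_1,B_2)/\sim$,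 where $\varphi_1\sim\varphi_2$ iff $(\varphi_1-\varphi_2)(\mathfrak{n}_{d,t})\subseteq \mathrm{Ker}(B_2)$; composition is induced by composition of endomorphisms. *)

(* Defs.v *)
From HB Require Import structures.
From mathcomp Require Import all_boot all_order all_algebra.
From mathcomp Require Import sesquilinear generic_quotient.
From mathcomp Require Import boolp.

Set Implicit Arguments.
Unset Strict Implicit.
Unset Printing Implicit Defensive.
Import GRing.Theory.
Local Open Scope ring_scope.
Local Open Scope quotient_scope.

HB.mixin Record isLieAlgebra (K : fieldType) L of Vector K L := {
  lie : L -> L -> L;
  lie_linearl : forall z, linear (lie^~ z);
  lie_linearr : forall z, linear (lie z);
  liexx : forall x, lie x x = 0;
  lie_jacobi : forall x y z,
    lie x (lie y z) + lie y (lie z x) + lie z (lie x y) = 0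
}.

#[short(type="lieAlgType")]
HB.structure Definition LieAlgebra (K : fieldType) :=
  {L of Vector K L & isLieAlgebra K L}.

Section LieTheory.
Variables (K : fieldType) (L : lieAlgType K).
Implicit Types (x y z : L) (U V W : {vspace L}).

HB.instance Definition _ := bilinear_isBilinear.Build K L L L
  (GRing.Scale.Law.clone _ _ *:%R _) (GRing.Scale.Law.clone _ _ *:%R _)
  (@lie K L) (lie_linearl, lie_linearr).

(* The span of all [u, v] with u in U and v in V, see lie_prodvP. *)
Definition lie_prodv U V : {vspace L} :=
  <<[seq lie u v | u <- vbasis U, v <- vbasis V]>>%VS.

Lemma memv_lie U V : {in U & V, forall u v, lie u v \in lie_prodv U V}.
Proof.
move=> u v /coord_vbasis-> /coord_vbasis->.
rewrite linear_sumlz; apply: memv_suml => i _.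
rewrite linearZl_LR memvZ // linear_sumr; apply: memv_suml => j _.
rewrite linearZr_LR memvZ // memv_span //.
by apply/allpairsP; exists ((vbasis U)`_i, (vbasis V)`_j); rewrite !memt_nth.
Qed.

Lemma lie_prodvP U V W :
  reflect {in U & V, forall u v, lie u v \in W} (lie_prodv U V <= W)%VS.
Proof.
apply: (iffP idP) => [sUVW u v Uu Vv | sUVW].
  by rewrite (subvP sUVW) ?memv_lie.
apply/span_subvP=> _ /allpairsP[[u v] /= [Uu Vv ->]].
by rewrite sUVW ?vbasis_mem.
Qed.

(* Indexed from 1: lcs 1 = L and lcs i.+1 = [lcs i, L]; lcs 0 is junk. *)
Definition lcs (i : nat) : {vspace L} :=
  iter i.-1 (fun U => lie_prodv U fullv) fullv.

End LieTheory.

Arguments lcs {K} L i.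

Definition lie_hom (K : fieldType) (L1 L2 : lieAlgType K) (f : 'Hom(L1, L2)) :=
  forall x y, f (lie x y) = lie (f x) (f y).

Definition is_free_nilpotent (K : fieldType) (d t : nat) (L : lieAlgType K)
    (x : 'I_d -> L) : Prop :=
  lcs L t.+1 = 0%VS /\
  forall (M : lieAlgType K) (y : 'I_d -> M), lcs M t.+1 = 0%VS ->
  exists! f : 'Hom(L, M), lie_hom f /\ forall i, f (x i) = y i.

Section Forms.
Variables (K : fieldType) (L : lieAlgType K).
Implicit Type B : {symmetric L}.

Definition invariant_form B := forall x y z, B (lie x y) z = B x (lie y z).

Definition Ker B : {vspace L} := orthov B fullv.

Lemma KerP B x : reflect (forall y, B x y = 0) (x \in Ker B).
Proof.
apply: (iffP idP) => [/mem_orthovP h y|h]; first exact/h/memvf.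
by apply/mem_orthovP => y _; exact: h.
Qed.

Lemma nondegenerateP B :
  reflect (forall x, (forall y, B x y = 0) -> x = 0) (nondegenerate B).
Proof.
apply: (iffP eqP) => [h x /KerP|h]; first by rewrite /Ker h memv0 => /eqP.
apply/eqP; rewrite -subv0; apply/subvP => x /KerP/h ->.
exact: mem0v.
Qed.

Definition quadratic B : Prop := invariant_form B /\ nondegenerate B.

End Forms.

Definition metric_isomorphic (K : fieldType) (L1 L2 : lieAlgType K)
    (B1 : {symmetric L1}) (B2 : {symmetric L2}) : Prop :=
  exists f : 'Hom(L1, L2), [/\ bijective f, lie_hom f & isometry B2 B1 f].

Section Ideals.
Variables (K : fieldType) (L : lieAlgType K).

Record lie_ideal := LieIdeal {
  ideal_space :> {vspace L};
  lie_idealP : forall x y, y \in ideal_space -> lie x y \in ideal_space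
}.

Variable I : lie_ideal.

Definition ideal_alg := subvs_of I.
HB.instance Definition _ := Vector.on ideal_alg.

Definition ideal_lie (x y : ideal_alg) : ideal_alg :=
  vsproj I (lie (vsval x) (vsval y)).

Lemma ideal_lieE x y : vsval (ideal_lie x y) = lie (vsval x) (vsval y).
Proof. by rewrite vsprojK // lie_idealP // subvsP. Qed.

Fact ideal_lie_linearl z : linear (ideal_lie^~ z).
Proof.
move=> a x y; apply: subvs_inj.
by rewrite linearP /= !ideal_lieE linearP /= lie_linearl.
Qed.

Fact ideal_lie_linearr z : linear (ideal_lie z).
Proof.
move=> a x y; apply: subvs_inj.
by rewrite linearP /= !ideal_lieE linearP /= lie_linearr.
Qed.

Fact ideal_liexx x : ideal_lie x x = 0.
Proof. by apply: subvs_inj; rewrite ideal_lieE liexx. Qed.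

Fact ideal_lie_jacobi x y z :
  ideal_lie x (ideal_lie y z) + ideal_lie y (ideal_lie z x)
    + ideal_lie z (ideal_lie x y) = 0.
Proof.
by apply: subvs_inj; rewrite !linearD /= !ideal_lieE lie_jacobi.
Qed.

HB.instance Definition _ := isLieAlgebra.Build K ideal_alg
  ideal_lie_linearl ideal_lie_linearr ideal_liexx ideal_lie_jacobi.

Variable B : {symmetric L}.

Definition restrict_form (x y : ideal_alg) : K := B (vsval x) (vsval y).

Fact restrict_form_bilinear : bilinear_for
  (GRing.Scale.Law.clone _ _ ( *%R ) _)
  (GRing.Scale.Law.clone _ _ (idfun \; *%R ) _) restrict_form.
Proof.
split=> [u'|u] a x y; rewrite /restrict_form.
  by rewrite [vsval (_ + _)]linearP linearPl.
by rewrite [vsval (_ + _)]linearP linearPr.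
Qed.

HB.instance Definition _ := bilinear_isBilinear.Build K ideal_alg ideal_alg K
  (GRing.Scale.Law.clone _ _ ( *%R ) _)
  (GRing.Scale.Law.clone _ _ (idfun \; *%R ) _)
  restrict_form restrict_form_bilinear.

Fact restrict_form_sym x y :
  restrict_form x y = (-1) ^+ false * idfun (restrict_form y x).
Proof. exact: hermC. Qed.

HB.instance Definition _ := isHermitianSesquilinear.Build K ideal_alg
  false idfun restrict_form restrict_form_sym.

End Ideals.

Record category := Category {
  cat_obj : Type;
  cat_hom : cat_obj -> cat_obj -> Type;
  cat_id : forall a, cat_hom a a;
  cat_comp : forall a b c, cat_hom b c -> cat_hom a b -> cat_hom a c;
  cat_comp1f : forall a b (f : cat_hom a b), cat_comp (cat_id b) f = f;
  cat_compf1 : forall a b (f : cat_hom a b), cat_comp f (cat_id a) = f;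
  cat_compA : forall a b c e
    (h : cat_hom c e) (g : cat_hom b c) (f : cat_hom a b),
    cat_comp h (cat_comp g f) = cat_comp (cat_comp h g) f
}.

Definition isomorphic (C : category) (a b : cat_obj C) : Prop :=
  exists (f : cat_hom a b) (g : cat_hom b a),
    cat_comp g f = cat_id a /\ cat_comp f g = cat_id b.

Section Sym0.
Variables (K : fieldType) (L : lieAlgType K) (t : nat).

Record Sym0_obj := Sym0Obj {
  sym0_form :> {symmetric L};
  _ : invariant_form sym0_form;
  _ : (Ker sym0_form <= lcs L 2)%VS;
  _ : ~~ (lcs L t <= Ker sym0_form)%VS
}.

Implicit Types B : Sym0_obj.

Definition is_MEnd B1 B2 (phi : 'End(L)) : Prop :=
  [/\ lie_hom phi, isometry B2 B1 phi & (phi @: Ker B1 <= Ker B2)%VS].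

Definition MEnd B1 B2 := {phi : 'End(L) | `[< is_MEnd B1 B2 phi >]}.

Lemma MEndP B1 B2 (f : MEnd B1 B2) : is_MEnd B1 B2 (val f).
Proof. exact/asboolP/(valP f). Qed.

Definition MEnd_rel B1 B2 (f g : MEnd B1 B2) : bool :=
  (limg (val f - val g)%R <= Ker B2)%VS.

Lemma MEnd_relP B1 B2 (f g : MEnd B1 B2) :
  reflect (forall x, val f x - val g x \in Ker B2) (MEnd_rel f g).
Proof.
apply: (iffP subvP) => [h x|h _ /memv_imgP[x _ ->]].
  have := h _ (memv_img (val f - val g)%R (memvf x)).
  by rewrite !lfunE /= !lfunE.
by rewrite !lfunE /= !lfunE /=; exact: h.
Qed.

Fact MEnd_rel_refl B1 B2 : reflexive (@MEnd_rel B1 B2).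
Proof. by move=> f; apply/MEnd_relP => x; rewrite subrr mem0v. Qed.

Fact MEnd_rel_sym B1 B2 : symmetric (@MEnd_rel B1 B2).
Proof.
by move=> f g; apply/MEnd_relP/MEnd_relP => h x; rewrite -opprB memvN.
Qed.

Fact MEnd_rel_trans B1 B2 : transitive (@MEnd_rel B1 B2).
Proof.
move=> g f h /MEnd_relP fg /MEnd_relP gh; apply/MEnd_relP => x.
by rewrite -(subrKA (val g x)) memvD.
Qed.

Canonical MEnd_equiv B1 B2 :=
  EquivRel (@MEnd_rel B1 B2) (@MEnd_rel_refl B1 B2) (@MEnd_rel_sym B1 B2)
    (@MEnd_rel_trans B1 B2).

Definition Sym0_hom B1 B2 := {eq_quot MEnd_equiv B1 B2}.

Fact is_MEnd_id B : `[< is_MEnd B B \1%VF >].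
Proof.
by apply/asboolP; split=> [x y|x y|]; rewrite ?lim1g // !id_lfunE.
Qed.

Definition MEnd_id B : MEnd B B := exist _ \1%VF (is_MEnd_id B).

Fact is_MEnd_comp B1 B2 B3 (g : MEnd B2 B3) (f : MEnd B1 B2) :
  `[< is_MEnd B1 B3 (val g \o val f)%VF >].
Proof.
have [gL gB gK] := MEndP g; have [fL fB fK] := MEndP f.
apply/asboolP; split=> [x y|x y|]; first by rewrite !comp_lfunE fL gL.
  by rewrite !comp_lfunE gB fB.
by rewrite limg_comp (subv_trans _ gK) // limgS.
Qed.

Definition MEnd_comp B1 B2 B3 (g : MEnd B2 B3) (f : MEnd B1 B2) : MEnd B1 B3 :=
  exist _ (val g \o val f)%VF (is_MEnd_comp g f).

Definition Sym0_id B : Sym0_hom B B := \pi_(Sym0_hom B B) (MEnd_id B).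

Definition Sym0_comp B1 B2 B3 (g : Sym0_hom B2 B3) (f : Sym0_hom B1 B2) :
  Sym0_hom B1 B3 := \pi_(Sym0_hom B1 B3) (MEnd_comp (repr g) (repr f)).

Lemma Sym0_compE B1 B2 B3 (g : MEnd B2 B3) (f : MEnd B1 B2) :
  Sym0_comp (\pi_(Sym0_hom B2 B3) g) (\pi_(Sym0_hom B1 B2) f) =
    \pi_(Sym0_hom B1 B3) (MEnd_comp g f).
Proof.
have piK B B' (h : MEnd B B') :
    MEnd_rel (repr (\pi_(Sym0_hom B B') h)) h.
  suff /eqmodP : repr (\pi_(Sym0_hom B B') h) = h %[mod Sym0_hom B B'] by [].
  by rewrite reprK.
apply/eqmodP/MEnd_relP => x; rewrite /= !comp_lfunE.
set g' := repr _; set f' := repr _.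
rewrite -(subrKA (val g' (val f x))) memvD //; last first.
  exact: (elimT (MEnd_relP _ _) (piK _ _ g)).
rewrite -linearB /=; have [_ _ /subvP gK] := MEndP g'.
apply/gK/memv_img; exact: (elimT (MEnd_relP _ _) (piK _ _ f)).
Qed.

Fact Sym0_comp1f B1 B2 (f : Sym0_hom B1 B2) : Sym0_comp (Sym0_id B2) f = f.
Proof.
rewrite -[f]reprK Sym0_compE; congr (\pi_(_) _); apply: val_inj.
exact: comp_lfun1l.
Qed.

Fact Sym0_compf1 B1 B2 (f : Sym0_hom B1 B2) : Sym0_comp f (Sym0_id B1) = f.
Proof.
rewrite -[f]reprK Sym0_compE; congr (\pi_(_) _); apply: val_inj.
exact: comp_lfun1r.
Qed.

Fact Sym0_compA B1 B2 B3 B4 (h : Sym0_hom B3 B4) (g : Sym0_hom B2 B3)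
    (f : Sym0_hom B1 B2) :
  Sym0_comp h (Sym0_comp g f) = Sym0_comp (Sym0_comp h g) f.
Proof.
rewrite -[f]reprK -[g]reprK -[h]reprK.
move: (repr f) (repr g) (repr h) => {}f {}g {}h.
rewrite (Sym0_compE g f) (Sym0_compE h g) !Sym0_compE.
congr (\pi_(_) _); by apply: val_inj; rewrite /= comp_lfunA.
Qed.

(* Sym_0(d, t) is obtained by taking for L the free t-nilpotent Lie algebra
   on d generators. *)
Definition Sym0 : category :=
  Category Sym0_comp1f Sym0_compf1 Sym0_compA.

End Sym0.

Section FreeAbelian.
Variables (K : fieldType) (d : nat).

Definition free_nilp1 := 'rV[K]_d.
HB.instance Definition _ := Vector.on free_nilp1.

Definition abelian_lie (x y : free_nilp1) : free_nilp1 := 0.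

Fact abelian_lie_linearl z : linear (abelian_lie^~ z).
Proof. by move=> a x y; rewrite /abelian_lie scaler0 addr0. Qed.

Fact abelian_lie_linearr z : linear (abelian_lie z).
Proof. by move=> a x y; rewrite /abelian_lie scaler0 addr0. Qed.

Fact abelian_liexx x : abelian_lie x x = 0.
Proof. by []. Qed.

Fact abelian_lie_jacobi x y z :
  abelian_lie x (abelian_lie y z) + abelian_lie y (abelian_lie z x)
    + abelian_lie z (abelian_lie x y) = 0.
Proof. by rewrite /abelian_lie !addr0. Qed.

HB.instance Definition _ := isLieAlgebra.Build K free_nilp1
  abelian_lie_linearl abelian_lie_linearr abelian_liexx abelian_lie_jacobi.

Definition free_gen (i : 'I_d) : free_nilp1 := delta_mx 0 i.

Lemma free_nilp1_free : is_free_nilpotent 1 free_gen.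
Proof.
split=> [|M y M1].
  apply/eqP; rewrite -subv0; apply/lie_prodvP => u v _ _.
  exact: mem0v.
have M0 (u v : M) : lie u v = 0.
  by apply/eqP; rewrite -memv0 -M1 memv_lie ?memvf.
have flin : linear (fun u : free_nilp1 => \sum_i u 0 i *: y i).
  move=> a u v; rewrite scaler_sumr -big_split /=; apply: eq_bigr => i _.
  by rewrite !mxE scalerDl scalerA.
pose f : {linear free_nilp1 -> M} := HB.pack
  (fun u : free_nilp1 => \sum_i u 0 i *: y i)
  (GRing.isLinear.Build K free_nilp1 M *:%R _ flin).
have fE i : f (free_gen i) = y i.
  rewrite /= (bigD1 i) //= big1 ?addr0 => [|j ji]; rewrite mxE eqxx ?eqxx.
    by rewrite scale1r.
  by rewrite (negPf ji) scale0r.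
exists (linfun f); split; first split=> [u v|i].
- by rewrite M0 linear0.
- by rewrite lfunE fE.
move=> g [_ gy]; apply/lfunP => u; rewrite lfunE.
rewrite [u]row_sum_delta !linear_sum; apply: eq_bigr => i _.
by rewrite !linearZ; congr (_ *: _); rewrite [LHS]fE -gy.
Qed.

(* u A v^T, a 1 x 1 trace in the library; matrix_form_gen identifies the matrix
   in the basis x_i. *)
Definition matrix_form (A : 'M[K]_d) : free_nilp1 -> free_nilp1 -> K :=
  form_of_matrix idfun A.

Lemma matrix_form_gen A i j : matrix_form A (free_gen i) (free_gen j) = A i j.
Proof. exact: rV_formee. Qed.

Definition congruent (A B : 'M[K]_d) : Prop :=
  exists2 P, P \in unitmx & B = P^T *m A *m P.

End FreeAbelian.

(* Main.v *)
(* The Lie algebra is abelian, so every form is invariant, every linear map is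
   a Lie homomorphism and Ker B <= n^2 = 0 forces B to be nondegenerate; hence
   homs in Sym_0(d, 1) are plain linear maps. A map u |-> u M is an isometry
   from u A1 v^T to u A2 v^T iff A1 = M A2 M^T, and regularity of A1 makes M
   invertible, so already a single isometry yields a congruence. The orthogonal
   decomposition is diagonalization of a symmetric form in characteristic
   other than 2: polarization gives an anisotropic x, and one continues in the
   orthogonal complement of x. *)

Require Import Defs.
From mathcomp Require Import all_boot all_order all_algebra sesquilinear.
From HB Require Import structures.
From mathcomp Require Import generic_quotient boolp.

Set Implicit Arguments.
Unset Strict Implicit.
Unset Printing Implicit Defensive.
Import GRing.Theory.
Local Open Scope ring_scope.

(** * Diagonalization of a symmetric form on a subspace *)

Section OrthogonalBasis.
Variables (K : fieldType) (L : vectType K) (B : {symmetric L}).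
Hypothesis two_neq0 : 2%:R != 0 :> K.

Lemma symmetricC x y : B x y = B y x.
Proof. by rewrite hermC expr0 mul1r. Qed.

(** Polarization: expanding [B (x + y) (x + y) = 0] leaves [2 * B x y = 0], and 2 is nonzero in
    [K]. *)
Lemma isotropic_subspace (V : {vspace L}) :
  {in V, forall x, B x x = 0} -> (V <= orthov B V)%VS.
Proof.
move=> Biso; apply/orthovP => x y Vx Vy.
have /eqP := Biso _ (memvD Vx Vy).
rewrite linearDl !linearD /= !Biso // add0r addr0 (symmetricC y x).
by rewrite -mulr2n -mulr_natl mulf_eq0 (negPf two_neq0) => /eqP.
Qed.

Lemma anisotropic_vector (V : {vspace L}) :
  (V :&: orthov B V = 0)%VS -> V != 0%VS -> exists2 x, x \in V & B x x != 0.
Proof.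
move=> VV0 Vn0; apply: contrapT => noV; case/eqP: Vn0.
rewrite -VV0; apply/esym/capv_idPl/isotropic_subspace => x Vx.
by apply: contrapT => /eqP Bx; apply: noV; exists x.
Qed.

Lemma orthov1_split (V : {vspace L}) x : x \in V -> B x x != 0 ->
  (<[x]> + (V :&: orthov B <[x]>) = V)%VS.
Proof.
move=> Vx Bx; apply/eqP; rewrite eqEsubv subv_add capvSl andbT -memvE Vx /=.
apply/subvP => v Vv; apply/memv_addP.
(* Gram-Schmidt coefficient: it makes [v - c *: x] orthogonal to [x]. *)
pose c := B v x / B x x; exists (c *: x); first exact/memvZ/memv_line.
exists (v - c *: x); last by rewrite addrC subrK.
rewrite memv_cap memvB ?memvZ //= mem_orthov1 linearBl linearZl_LR /=.
by rewrite divfK ?subrr.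
Qed.

(** Induction on the dimension. Nondegeneracy is stated for the restriction of [B] to [V], so that
    it can pass to the complement [W] of an anisotropic [x] in [V]. *)
Lemma orthogonal_basis (V : {vspace L}) : (V :&: orthov B V = 0)%VS ->
  exists X : seq L, [/\ basis_of V X, {in X, forall x, B x x != 0}
                      & pairwise (fun x y => B x y == 0) X].
Proof.
have [n] := ubnP (\dim V); elim: n V => // n IHn V dimV VV0.
have [->|/(anisotropic_vector VV0)[x Vx Bx]] := eqVneq V 0%VS.
  by exists [::]; split=> //; rewrite basisEfree nil_free span_nil subvv dimv0.
pose W := (V :&: orthov B <[x]>)%VS.
have splitV : (<[x]> + W = V)%VS := orthov1_split Vx Bx.
have orthW w : w \in W -> B x w = 0.
  rewrite memv_cap mem_orthov1 symmetricC => /andP[_ /eqP //].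
(* Used twice: the dimension drops from [V] to [W], and [x :: X] stays free. *)
have xW : x \notin W by apply: contra Bx => /orthW ->.
have dimW : (\dim W < n)%N.
  rewrite -ltnS (leq_trans _ dimV) // ltnS ltn_neqAle dimvS ?capvSl // andbT.
  apply: contraNneq xW => dimWV.
  by have /eqP -> : W == V by rewrite eqEdim capvSl dimWV /=.
(* A vector of [W] orthogonal to [W] is also orthogonal to [x], hence to [<[x]> + W = V]. *)
have WW0 : (W :&: orthov B W = 0)%VS.
  apply/eqP; rewrite -subv0 -VV0; apply/subvP => w.
  rewrite !memv_cap => /andP[/[dup] Ww /andP[Vw wx] /mem_orthovP wW].
  rewrite Vw -splitV.
  apply/mem_orthovP => _ /memv_addP[_ /vlineP[k ->] [w' Ww' ->]].
  have Bwx : B w x = 0 by apply/eqP; rewrite -mem_orthov1.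
  by rewrite linearDr /= linearZr_LR /= Bwx mulr0 add0r wW.
have [X [Xbasis XB Xorth]] := IHn W dimW WW0.
have sX := span_basis Xbasis.
exists (x :: X); split.
- rewrite /basis_of span_cons sX splitV eqxx free_cons sX xW /=.
  exact: basis_free Xbasis.
- by move=> y; rewrite inE => /predU1P[->//|/XB].
- rewrite /= Xorth andbT; apply/allP => y yX.
  by apply/eqP/orthW; rewrite -sX memv_span.
Qed.

End OrthogonalBasis.

(** * Symmetric forms on the abelian algebra and their matrices *)

Section FreeAbelianForms.
Variables (K : fieldType) (d : nat).
Local Notation L := (free_nilp1 K d).
Implicit Types (A P M : 'M[K]_d) (B : {symmetric L}) (u v : L).

Lemma matrix_formE A u v : matrix_form A u v = (u *m A *m v^T) 0 0.
Proof.
by rewrite /matrix_form /form_of_matrix trace_mx11 eq_map_mx_id.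
Qed.

Lemma matrix_form_mulmx A M u v :
  matrix_form A (u *m M : 'rV_d) (v *m M : 'rV_d) =
  matrix_form (M *m A *m M^T) u v.
Proof. by rewrite !matrix_formE trmx_mul !mulmxA. Qed.

Lemma matrix_form_inj A1 A2 : matrix_form A1 =2 matrix_form A2 -> A1 = A2.
Proof. by move=> eqA; apply/matrixP => i j; rewrite -!matrix_form_gen eqA. Qed.

Lemma symmetric_form_matrix B : exists2 A, A^T = A & B =2 matrix_form A.
Proof.
exists (matrix_of_form (B : 'rV_d -> 'rV_d -> K)).
  by apply/matrixP => i j; rewrite !mxE symmetricC.
move=> u v; apply/esym; exact: (matrix_of_formK B).
Qed.

Lemma matrix_symmetric_form A :
  A^T = A -> exists B : {symmetric L}, B =2 matrix_form A.
Proof.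
move=> symA.
have bilin : bilinear_for (GRing.Scale.Law.clone _ _ ( *%R ) _)
    (GRing.Scale.Law.clone _ _ (idfun \; *%R ) _)
    (matrix_form A : L -> L -> K).
  exact: form_of_matrix_is_bilinear.
have sym u v : matrix_form A u v = (-1) ^+ false * idfun (matrix_form A v u).
  rewrite expr0 mul1r /= !matrix_formE -[in RHS]symA.
  (* A 1 x 1 matrix and its transpose have the same entry. *)
  rewrite (_ : v *m _ *m _ = (u *m A *m v^T)^T) ?mxE //.
  by rewrite !trmx_mul trmxK mulmxA.
(* Symmetry rests on the hypothesis [symA], so the structure is packed inside the proof. *)
pose bB := bilinear_isBilinear.Build K L L K
  (GRing.Scale.Law.clone _ _ ( *%R ) _)
  (GRing.Scale.Law.clone _ _ (idfun \; *%R ) _) (matrix_form A) bilin.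
pose hB := isHermitianSesquilinear.Build K L false idfun (matrix_form A) sym.
pose B : {symmetric L} := HB.pack (matrix_form A : L -> L -> K) bB hB.
by exists B.
Qed.

Lemma invariant_free_nilp1 B : invariant_form B.
Proof. by move=> x y z; rewrite linear0l linear0r. Qed.

Lemma lcs2_free_nilp1 : lcs L 2 = 0%VS.
Proof. exact: (proj1 (free_nilp1_free K d)). Qed.

(** The radical of [B] is the left kernel of [A]: pairing [x] with the standard basis reads off the
    entries of [x *m A]. *)
Lemma unitmx_nondegenerate A B :
  B =2 matrix_form A -> reflect (nondegenerate B) (A \in unitmx).
Proof.
move=> BA; apply: (iffP idP) => [uA|/nondegenerateP ndB].
  apply/nondegenerateP => x Bx.
  have xA0 : x *m A = 0.
    apply/rowP => j; rewrite [RHS]mxE -(Bx (delta_mx 0 j)) BA matrix_formE.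
    by rewrite trmx_delta -colE [RHS]mxE.
  by rewrite -[LHS](mulmxK uA) xA0 mul0mx.
rewrite -row_free_unit -kermx_eq0; apply/rowV0P => x /sub_kermxP xA0.
by apply: ndB => y; rewrite BA matrix_formE xA0 mul0mx mxE.
Qed.

Lemma nondegenerate_Sym0 (B : Sym0_obj L 1) : nondegenerate B.
Proof.
case: B => B invB KB nKB /=.
by rewrite /nondegenerate -subv0 -[X in (_ <= X)%VS]lcs2_free_nilp1.
Qed.

(** * Isometries and congruence of matrices *)

Lemma isometry_mulmx A1 A2 (B1 B2 : {symmetric L}) M (f : 'End(L)) :
    B1 =2 matrix_form A1 -> B2 =2 matrix_form A2 ->
    (forall u, f u = u *m M :> 'rV_d) ->
  isometry B2 B1 f <-> A1 = M *m A2 *m M^T.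
Proof.
move=> BA1 BA2 fE; split=> [isof|A1E u v]; last first.
  by rewrite BA1 BA2 !fE matrix_form_mulmx A1E.
apply: matrix_form_inj => u v.
by rewrite -BA1 -isof BA2 !fE matrix_form_mulmx.
Qed.

Lemma isometry_congruent A1 A2 (B1 B2 : {symmetric L}) (f : 'End(L)) :
    B1 =2 matrix_form A1 -> B2 =2 matrix_form A2 -> A1 \in unitmx ->
  isometry B2 B1 f -> congruent A1 A2.
Proof.
move=> BA1 BA2 uA1.
pose M := lin1_mx (f : 'rV[K]_d -> 'rV[K]_d).
have fE u : f u = u *m M by rewrite mul_rV_lin1.
move=> /(isometry_mulmx BA1 BA2 fE) A1E.
have uM : M \in unitmx by move: uA1; rewrite A1E !unitmx_mul => /andP[/andP[]].
(* Maps act on row vectors from the right, whence the transpose: solving [A1 = M *m A2 *m M^T] for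
   [A2] gives [P^T = invmx M]. *)
exists (invmx M)^T; first by rewrite unitmx_tr unitmx_inv.
rewrite trmxK A1E -!mulmxA -trmx_mul mulVmx // trmx1 mulmx1.
by rewrite mulKmx.
Qed.

(** Right multiplications by [invmx P^T] and [P^T]. The explicit inverse serves both as inverse
    morphism in the category and as witness of bijectivity. *)
Lemma congruent_isometry A1 A2 (B1 B2 : {symmetric L}) :
    B1 =2 matrix_form A1 -> B2 =2 matrix_form A2 -> congruent A1 A2 ->
  exists f g : 'End(L), [/\ isometry B2 B1 f, isometry B1 B2 g,
    (g \o f = \1)%VF & (f \o g = \1)%VF].
Proof.
move=> BA1 BA2 [P uP A2E].
pose rmul M : 'End(L) := linfun (mulmxr M : 'rV_d -> 'rV_d).
have rmulE M u : rmul M u = u *m M :> 'rV_d by rewrite lfunE.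
exists (rmul (invmx P^T)), (rmul P^T); split.
- apply/(isometry_mulmx BA1 BA2 (rmulE _)); rewrite A2E.
  by rewrite !mulmxA mulVmx ?unitmx_tr // mul1mx trmx_inv trmxK mulmxK.
- by apply/(isometry_mulmx BA2 BA1 (rmulE _)); rewrite trmxK.
- by apply/lfunP => u; rewrite comp_lfunE id_lfunE !rmulE mulmxKV ?unitmx_tr.
- by apply/lfunP => u; rewrite comp_lfunE id_lfunE !rmulE mulmxK ?unitmx_tr.
Qed.

Lemma isomorphic_congruent A1 A2 (B1 B2 : Sym0_obj L 1) :
    B1 =2 matrix_form A1 -> B2 =2 matrix_form A2 ->
  @isomorphic (Sym0 L 1) B1 B2 <-> congruent A1 A2.
Proof.
move=> BA1 BA2.
have uA1 := introT (unitmx_nondegenerate BA1) (nondegenerate_Sym0 B1).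
split=> [[f _]|].
  (* Any representative of the class is an isometry. *)
  have [_ isof _] := MEndP (repr (f : Sym0_hom B1 B2)).
  exact: isometry_congruent BA1 BA2 uA1 isof.
case/(congruent_isometry BA1 BA2) => f [g [isof isog gf fg]].
(* Brackets are 0 and [Ker C1 = 0], so an isometry meets the other two conditions automatically. *)
have isoMEnd (C1 C2 : Sym0_obj L 1) (h : 'End(L)) :
    isometry C2 C1 h -> `[< is_MEnd C1 C2 h >].
  move=> isoh; apply/asboolP; split=> // [x y|]; first by rewrite linear0.
  by rewrite /Ker (eqP (nondegenerate_Sym0 C1)) limg0 sub0v.
pose f' : MEnd B1 B2 := exist _ f (isoMEnd _ _ _ isof).
pose g' : MEnd B2 B1 := exist _ g (isoMEnd _ _ _ isog).
exists (\pi_(Sym0_hom B1 B2) f')%qT, (\pi_(Sym0_hom B2 B1) g')%qT.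
split; rewrite /= Sym0_compE; congr (\pi_(_) _)%qT; exact: val_inj.
Qed.

Lemma metric_isomorphic_congruent A1 A2 (B1 B2 : {symmetric L}) :
    B1 =2 matrix_form A1 -> B2 =2 matrix_form A2 -> nondegenerate B1 ->
  metric_isomorphic B1 B2 <-> congruent A1 A2.
Proof.
move=> BA1 BA2 /(introT (unitmx_nondegenerate BA1)) uA1.
split=> [[f [_ _ isof]]|]; first exact: isometry_congruent BA1 BA2 uA1 isof.
case/(congruent_isometry BA1 BA2) => f [g [isof _ gf fg]].
exists f; split=> //; last by move=> x y; rewrite linear0.
by exists g => u; rewrite -comp_lfunE ?gf ?fg id_lfunE.
Qed.

(** * Orthogonal decomposition into lines *)

Lemma orthogonal_line_decomposition B : 2%:R != 0 :> K -> nondegenerate B ->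
  exists (m : nat) (I : 'I_m -> lie_ideal L),
    [/\ (\sum_(i < m) I i)%VS = fullv,
        directv (\sum_(i < m) I i),
        forall i j, i != j -> (I i <= orthov B (I j))%VS
      & forall i, \dim (I i) = 1%N /\
          quadratic (restrict_form (I := I i) B : {symmetric _})].
Proof.
move=> two_neq0 /eqP ndB.
have [|X [Xbasis XB /(pairwiseP 0) Xorth]] :=
    @orthogonal_basis _ _ B two_neq0 fullv.
  by rewrite ndB capv0.
(* The bracket computes to 0, so every line is an ideal. *)
pose I (i : 'I_(size X)) : lie_ideal L :=
  @LieIdeal K L <[X`_i]>%VS (fun x y _ => mem0v _).
have BI (i : 'I_(size X)) : B X`_i X`_i != 0 by rewrite XB ?mem_nth.
exists (size X), I; split.
- by rewrite -(span_basis Xbasis) span_def (big_nth 0) big_mkord.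
(* Freeness of [X] contains the directness of the sum of its lines; the rest reindexes from elements
   to positions. *)
- have := basis_free Xbasis; rewrite free_directv => /andP[_].
  rewrite !directvE /= (big_nth 0) big_mkord => /eqP dimX.
  by apply/eqP; rewrite dimX (big_nth 0) big_mkord.
- move=> i j ij; rewrite orthov11.
  have [lt_ij|lt_ji|/val_inj/eqP] := ltngtP i j.
  + by apply: Xorth => //; rewrite inE.
  + by rewrite symmetricC; apply: Xorth => //; rewrite inE.
  + by rewrite (negPf ij).
- move=> i; split.
    rewrite dim_vline; apply/eqP; rewrite eqb1.
    by apply: contraNneq (BI i) => ->; rewrite linear0l.
  have lieI0 (x y : ideal_alg (I i)) : lie x y = 0.
    by apply: subvs_inj; rewrite linear0; exact: ideal_lieE.
  split=> [x y z|]; first by rewrite !lieI0 linear0l linear0r.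
  apply/nondegenerateP => x Bx; apply: subvs_inj; rewrite linear0.
  (* Writing [x] as a multiple of the generator and pairing it with that anisotropic generator
     forces the coefficient to be 0. *)
  have : B (vsval x) (vsval (vsproj (I i) X`_i)) = 0 := Bx _.
  rewrite vsprojK ?memv_line //.
  have /vlineP[k ->] := subvsP x; rewrite linearZl_LR /= => /eqP.
  by rewrite mulf_eq0 (negPf (BI i)) orbF => /eqP ->; rewrite scale0r.
Qed.

End FreeAbelianForms.

Theorem theorem5p1 (K : fieldType) (charK : [pchar K] =i pred0)
    (d : nat) (d_gt0 : (0 < d)%N) :
  [/\ [/\ forall B : Sym0_obj (free_nilp1 K d) 1,
            nondegenerate B /\
            exists A : 'M[K]_d,
              [/\ A^T = A, A \in unitmx & B =2 matrix_form A]
        & forall A : 'M[K]_d, A^T = A -> A \in unitmx ->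
            exists B : Sym0_obj (free_nilp1 K d) 1, B =2 matrix_form A],
      forall (A1 A2 : 'M[K]_d) (B1 B2 : Sym0_obj (free_nilp1 K d) 1),
        B1 =2 matrix_form A1 -> B2 =2 matrix_form A2 ->
        @isomorphic (Sym0 (free_nilp1 K d) 1) B1 B2 <-> congruent A1 A2,
      forall (A : 'M[K]_d) (B : {symmetric free_nilp1 K d}),
        B =2 matrix_form A -> quadratic B ->
        exists (m : nat) (I : 'I_m -> lie_ideal (free_nilp1 K d)),
          [/\ (\sum_(i < m) I i)%VS = fullv,
              directv (\sum_(i < m) I i),
              forall i j, i != j -> (I i <= orthov B (I j))%VS
            & forall i, \dim (I i) = 1%N /\
                quadratic (restrict_form (I := I i) B : {symmetric _})]
    & forall (A1 A2 : 'M[K]_d) (B1 B2 : {symmetric free_nilp1 K d}),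
        B1 =2 matrix_form A1 -> B2 =2 matrix_form A2 ->
        quadratic B1 -> quadratic B2 ->
        metric_isomorphic B1 B2 <-> congruent A1 A2].
Proof.
have two_neq0 : 2%:R != 0 :> K.
  by have /negbT := charK 2; rewrite inE.
split; first split=> [B|A symA uA].
- have ndB := nondegenerate_Sym0 B; split=> //.
  have [A symA BA] := symmetric_form_matrix B.
  by exists A; split=> //; apply/(unitmx_nondegenerate BA).
- have [B BA] := matrix_symmetric_form symA.
  have ndB : nondegenerate B by apply/(unitmx_nondegenerate BA).
  have KB : Ker B = 0%VS by apply/eqP.
  unshelve eexists (@Sym0Obj K (free_nilp1 K d) 1 B _ _ _) => //.
  + exact: invariant_free_nilp1.
  + by rewrite KB sub0v.
  (* [lcs L 1] is the whole space, of dimension [1 * d]; it is nonzero by [d_gt0]. *)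
  + by rewrite KB subv0 -dimv_eq0 dimvf /dim /= mul1n -lt0n.
- by move=> A1 A2 B1 B2; exact: isomorphic_congruent.
- by move=> A B _ [_]; exact: orthogonal_line_decomposition.
- by move=> A1 A2 B1 B2 BA1 BA2 [_ ndB1] _; exact: metric_isomorphic_congruent.
Qed.
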